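(* For any probability measure $\mu$ on $\mathbb{R}$, $$\left(\int(|x|-1)^2\,d\mu(x)\right)^{1/2}\le D^*(\mu|\mathrm{b}).$$ In particular, if $\mu$ is symmetric, then $$W_2(\mu,\mathrm{b})\le D^*(\mu|\mathrm{b}).$$
   Context: $\mathrm{b}=\frac12\delta_{-1}+\frac12\delta_{1}$ is the Rademacher distribution. $W_2(\mu,\nu)=\inf_\pi\left(\iint|x-y|^2\,d\pi(x,y)\right)^{1/2}$, the infimum being over all couplings of $(\mu,\nu)$. The Boolean Stein discrepancy of a probability measure $\mu$ on $\mathbb{R}$ with respect to $\mathrm{b}$ is $D^*(\mu|\mathrm{b})=\left(\int(x^2-1)^2\,d\mu(x)\right)^{1/2}\in[0,+\infty]$. *)

(* Defs.v *)
From HB Require Import structures.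
From mathcomp Require Import all_boot all_order all_algebra.
From mathcomp Require Import all_classical all_reals all_analysis.

Set Implicit Arguments.
Unset Strict Implicit.
Unset Printing Implicit Defensive.

Import Order.TTheory GRing.Theory Num.Theory.
Import numFieldNormedType.Exports.

Local Open Scope classical_set_scope.
Local Open Scope ring_scope.
Local Open Scope ereal_scope.

Definition rademacher (R : realType) : set (measurableTypeR R) -> \bar R :=
  measure_add (mscale ((2^-1)%:nng)%R \d_(-1 : measurableTypeR R)%R)
              (mscale ((2^-1)%:nng)%R \d_(1 : measurableTypeR R)%R).

HB.instance Definition _ (R : realType) := Measure.on (@rademacher R).

Lemma rademacher_setT (R : realType) : @rademacher R setT = 1.
Proof.
rewrite /rademacher measure_addE /= /mscale /= !diracT !mule1 -EFinD.
by rewrite [RHS](congr1 EFin (splitr 1%R)) !mul1r.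
Qed.

HB.instance Definition _ (R : realType) :=
  Measure_isProbability.Build _ _ _ (@rademacher R) (@rademacher_setT R).

(* Measures are functions on all sets, so they are compared on measurable
   sets only, here and in [symmetric_measure]. *)
Definition coupling (R : realType) (mu nu : probability (measurableTypeR R) R)
    (pi : probability (measurableTypeR R * measurableTypeR R)%type R) : Prop :=
  forall A : set (measurableTypeR R), measurable A ->
    pushforward pi fst A = mu A /\ pushforward pi snd A = nu A.

Definition wasserstein2 (R : realType)
    (mu nu : probability (measurableTypeR R) R) : \bar R :=
  ereal_inf [set sqrte (\int[pi]_z (`|z.1 - z.2| ^+ 2)%:E)
            | pi in [set pi | coupling mu nu pi]].

Definition boolean_stein_discrepancy (R : realType)
    (mu : probability (measurableTypeR R) R) : \bar R :=
  sqrte (\int[mu]_x ((x ^+ 2 - 1) ^+ 2)%:E).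

Definition symmetric_measure (R : realType)
    (mu : probability (measurableTypeR R) R) : Prop :=
  forall A : set (measurableTypeR R), measurable A ->
    pushforward mu (-%R : measurableTypeR R -> measurableTypeR R) A = mu A.

(* Main.v *)
(* Since |x^2 - 1| = ||x| - 1| (|x| + 1) >= ||x| - 1| pointwise, the first
   inequality follows by integration. If mu is symmetric, with s a sign function
   (any choice in {-1, 1} at 0), the law of (e X, e s(X)) for X ~ mu and e an
   independent fair sign is a coupling of mu and the Rademacher law: averaging
   over e makes the second marginal symmetric even if mu has an atom at 0.
   Its cost is |x - s(x)|^2 = (|x| - 1)^2 for both values of e. *)
Require Import Defs.
From HB Require Import structures.
From mathcomp Require Import all_boot all_order all_algebra.
From mathcomp Require Import all_classical all_reals all_analysis.
From mathcomp Require Import measurable_realfun.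
Set Implicit Arguments.
Unset Strict Implicit.
Unset Printing Implicit Defensive.
Import Order.TTheory GRing.Theory Num.Theory.
Import numFieldNormedType.Exports.
Local Open Scope classical_set_scope.
Local Open Scope ring_scope.
Local Open Scope ereal_scope.

(** Stated in the extended reals so that it also covers integrals equal to [+oo]; nonnegativity
    justifies distributing the product over the sum. *)
Lemma half_mule2 (R : realFieldType) (x : \bar R) :
  0 <= x -> (2^-1)%:E * (x + x) = x.
Proof.
move=> x0; rewrite ge0_muleDr// -ge0_muleDl// -EFinD.
by rewrite -[(2^-1)%R]mul1r -splitr mul1e.
Qed.

Section half_mixture.
Context d (T : measurableType d) (R : realType) (P Q : probability T R).

Definition half_mixture : set T -> \bar R :=
  measure_add (mscale ((2^-1)%:nng)%R P) (mscale ((2^-1)%:nng)%R Q).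

HB.instance Definition _ := Measure.on half_mixture.

Lemma half_mixtureE A : half_mixture A = (2^-1)%:E * (P A + Q A).
Proof.
by rewrite /half_mixture measure_addE /= /mscale /= ge0_muleDr.
Qed.

Lemma half_mixture_setT : half_mixture setT = 1.
Proof. by rewrite half_mixtureE !probability_setT half_mule2. Qed.

HB.instance Definition _ :=
  Measure_isProbability.Build _ _ _ half_mixture half_mixture_setT.

Lemma ge0_integral_half_mixture (f : T -> \bar R) :
  (forall x, 0 <= f x) -> measurable_fun [set: T] f ->
  \int[half_mixture]_x f x =
  (2^-1)%:E * (\int[P]_x f x + \int[Q]_x f x).
Proof.
move=> f0 mf; rewrite /half_mixture ge0_integral_measure_add//.
rewrite !ge0_integral_mscale// [RHS]ge0_muleDr//; exact: integral_ge0.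
Qed.

End half_mixture.

Section sign_coupling.
Context (R : realType).
Local Notation M := (measurableTypeR R).

(** The value at 0 is 1, so that the range is exactly {-1, 1}. *)
Definition unit_sign (x : M) : M := (if 0 <= x then 1 else -1)%R.

Definition sign_graph (x : M) : (M * M)%type := (x, unit_sign x).

Definition opp_sign_graph (x : M) : (M * M)%type := (- x, - unit_sign x)%R.

Lemma measurable_unit_sign : measurable_fun [set: M] unit_sign.
Proof.
by apply: measurable_fun_ifT => //; exact: measurable_fun_ler.
Qed.

Lemma measurable_sign_graph : measurable_fun [set: M] sign_graph.
Proof. exact: measurable_fun_pair measurable_unit_sign. Qed.

Lemma measurable_opp_sign_graph : measurable_fun [set: M] opp_sign_graph.
Proof.
apply: measurable_fun_pair; first exact: oppr_measurable.
exact: measurableT_comp measurable_unit_sign.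
Qed.

HB.instance Definition _ :=
  isMeasurableFun.Build _ _ _ _ sign_graph measurable_sign_graph.
HB.instance Definition _ :=
  isMeasurableFun.Build _ _ _ _ opp_sign_graph measurable_opp_sign_graph.

(** The fair sign e is encoded by an equal mixture of the conditional laws given e = 1 and e =
    -1. *)
Definition sign_coupling (mu : probability M R) : probability (M * M)%type R :=
  half_mixture (distribution mu sign_graph) (distribution mu opp_sign_graph).

(** The variables s(X) and -s(X) always form the pair {-1, 1} in some order, so both sides count how
    many of these two points lie in [A]. *)
Lemma unit_sign_split (mu : probability M R) (A : set M) : measurable A ->
  mu (unit_sign @^-1` A) + mu ((fun x => - unit_sign x)%R @^-1` A) =
  \d_(-1 : M)%R A + \d_(1 : M)%R A.
Proof.
move=> mA; pose B := unit_sign @^-1` A.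
have mB : measurable B.
  by rewrite /B -[X in measurable X]setTI; exact: measurable_unit_sign.
have sgnP x : unit_sign x = 1%R \/ unit_sign x = (-1)%R.
  by rewrite /unit_sign; case: ifP; [left|right].
rewrite !diracE.
have [A1|A1] := pselect (A 1%R); have [AN1|AN1] := pselect (A (-1)%R).
- rewrite [X in mu X](_ : _ = setT); last first.
    by apply/seteqP; split => // x _ /=; have [->|->] := sgnP x.
  rewrite [X in _ + mu X](_ : _ = setT); last first.
    by apply/seteqP; split => // x _ /=; have [->|->] := sgnP x; rewrite ?opprK.
  by rewrite !probability_setT !mem_set.
(* Exactly one of the two points lies in [A]: the preimages are complementary, and their masses add
   up to 1. *)
- rewrite [X in _ + mu X](_ : _ = ~` B); last first.
    apply/seteqP; split => x; rewrite /B/=;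
      by have [->|->] := sgnP x; rewrite ?opprK; tauto.
  rewrite probability_setC// addeC subeK ?fin_num_measure//.
  by rewrite (mem_set A1) memNset// add0e.
- rewrite [X in _ + mu X](_ : _ = ~` B); last first.
    apply/seteqP; split => x; rewrite /B/=;
      by have [->|->] := sgnP x; rewrite ?opprK; tauto.
  rewrite probability_setC// addeC subeK ?fin_num_measure//.
  by rewrite (mem_set AN1) memNset// adde0.
- rewrite [X in mu X](_ : _ = set0); last first.
    by apply/seteqP; split => // x /=; have [->|->] := sgnP x.
  rewrite [X in _ + mu X](_ : _ = set0); last first.
    by apply/seteqP; split => // x /=; have [->|->] := sgnP x; rewrite ?opprK.
  by rewrite !measure0 !memNset.
Qed.

Lemma coupling_sign_coupling (mu : probability M R) :
  symmetric_measure mu -> coupling mu (@rademacher R) (sign_coupling mu).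
Proof.
move=> mu_sym A mA; split; rewrite /pushforward [LHS]half_mixtureE /distribution.
  (* First marginal: the average of [mu] and its reflection, which agree by symmetry. *)
  rewrite -[RHS]half_mule2//; congr (_ * (_ + _)); exact: mu_sym.
rewrite [RHS]measure_addE /= /mscale /= -ge0_muleDr//.
by congr (_ * _); exact: unit_sign_split.
Qed.

(** The difference x - s(x) is |x| - 1 for x >= 0 and 1 - |x| for x < 0. *)
Lemma sqr_dist_unit_sign (x : R) :
  (`|x - unit_sign x| ^+ 2 = (`|x| - 1) ^+ 2)%R.
Proof.
rewrite /unit_sign real_normK ?num_real//; case: ifPn => [x0|].
  by rewrite ger0_norm.
by rewrite -ltNge => x0; rewrite ltr0_norm// -[RHS]sqrrN opprB !opprK addrC.
Qed.

Lemma integral_sign_coupling (mu : probability M R) :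
  \int[sign_coupling mu]_z (`|z.1 - z.2| ^+ 2)%:E =
  \int[mu]_x ((`|x| - 1) ^+ 2)%:E.
Proof.
have cost_ge0 (z : M * M) : 0 <= (`|z.1 - z.2| ^+ 2)%:E.
  by rewrite lee_fin exprn_ge0.
have mcost : measurable_fun [set: M * M] (fun z => (`|z.1 - z.2| ^+ 2)%:E).
  apply/measurable_EFinP; apply: measurable_funX.
  apply: measurableT_comp => //; apply: measurable_funB.
    exact: measurable_fst.
  exact: measurable_snd.
rewrite ge0_integral_half_mixture// !ge0_integral_distribution//=.
(* Changing the sign of both coordinates preserves their distance, so the two halves have equal
   cost. *)
under [X in _ + X]eq_integral do rewrite /= -opprD normrN.
under eq_integral do rewrite /= sqr_dist_unit_sign.
by rewrite half_mule2// integral_ge0// => x _; rewrite lee_fin sqr_ge0.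
Qed.

End sign_coupling.

Lemma sqr_normB1_le (R : realDomainType) (x : R) :
  ((`|x| - 1) ^+ 2 <= (x ^+ 2 - 1) ^+ 2)%R.
Proof.
rewrite -[(x ^+ 2)%R]real_normK ?num_real//; set a := `|x|%R.
have a0 : (0 <= a)%R by exact: normr_ge0.
(* With a^2 - 1 = (a - 1)(a + 1), it remains to see that (a + 1)^2 >= 1. *)
rewrite subr_sqr_1 exprMn ler_peMr ?sqr_ge0// expr_ge1 ?addr_ge0//.
by rewrite lerDr.
Qed.

Theorem proposition3p7 (R : realType)
    (mu : probability (measurableTypeR R) R) :
  sqrte (\int[mu]_x ((`|x| - 1) ^+ 2)%:E) <= boolean_stein_discrepancy mu
  /\ (symmetric_measure mu ->
      wasserstein2 mu (@rademacher R) <= boolean_stein_discrepancy mu).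
Proof.
have discr_ge : sqrte (\int[mu]_x ((`|x| - 1) ^+ 2)%:E) <=
    boolean_stein_discrepancy mu.
  rewrite lee_sqrt; last by apply: integral_ge0 => x _; rewrite lee_fin sqr_ge0.
  apply: ge0_le_integral => //.
  - by move=> x _; rewrite lee_fin sqr_ge0.
  - apply/measurable_EFinP; apply: measurable_funX; exact: measurable_funB.
  - apply/measurable_EFinP; apply: measurable_funX; exact: measurable_funB.
  - by move=> x _; rewrite lee_fin sqr_normB1_le.
split=> // mu_sym; apply: le_trans discr_ge.
(* The infimum is at most the cost of this one coupling, which is the left side of the first
   inequality. *)
apply: ereal_inf_lbound; exists (sign_coupling mu).
  exact: coupling_sign_coupling.
by rewrite integral_sign_coupling.
Qed.
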